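(* Let $F_2=\langle a_1,a_2\rangle$ be the free group of rank two. If $w=\prod_{i=1}^l a_{k_i}^{p_i}\in F_2$ is a word without isolated generators, i.e. $l>0$, $k_i\in\{1,2\}$, $k_i\neq k_{i+1}$ and $|p_i|>1$ for all $i$ (indices modulo $l$), then $\rho(w)\in\mathcal T_2$. In particular, $w$ is polygonal.
   Context: Let $V_2=\{\pm1,\pm2\}$ and $E_2=\{(i,j)\in V_2\times V_2 : |i|\ne|j|\}$. Let $\mathcal A_2^*$ be the free abelian monoid on the set $E_2$ and let $\mathcal A_2$ be its quotient by the relations $(i,j)=(-j,-i)$. Let $\mathcal T_2\le\mathcal A_2$ be the submonoid generated by all elements $(c_1,c_2)+(c_2,c_3)+\cdots+(c_r,c_1)$ where $c_1,\dots,c_r\in V_2$ are all distinct (and each consecutive pair lies in $E_2$). For $w=\prod_{i=1}^l a_{k_i}^{p_i}$ as in the claim, $\rho(w)=\sum_{i=1}^l(\operatorname{sign}(p_i)k_i,\operatorname{sign}(p_{i+1})k_{i+1})\in\mathcal A_2$, indices modulo $l$. Polygonality. Let $R$ be the bouquet of two oriented circles labeled $a_1,a_2$, so that $\pi_1(R)=F_2$. A graph is a 1-dimensional CW-complex; a graph map sends vertices to vertices and edges to edges; an immersion is a locally injective graph map. An immersion from a graph to $R$ induces an orientation and a label on each edge of the graph. A polygonal disk $P$ is a 2-disk whose boundary $\partial P$ has the CW-structure of a polygon. A side-pairing $\sim$ on polygonal disks $P_1,\dots,P_m$ is an equivalence relation on the set of all edges of $\coprod_i\partial P_i$ with every class of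 size exactly two, together with a choice of homeomorphism between the edges in each class. Then $S=\coprod_i P_i/\!\sim$ is a closed surface with a CW-structure having $m(S)=m$ two-cells. For a cyclically reduced word $w\in F_2$, $S$ is a closed $w$-polygonal surface if there is an immersion $\phi\colon S^{(1)}\to R$ such that for every $i$ the composition $\partial P_i\to S^{(1)}\to R$ is an immersion reading (from a suitable starting vertex and in a suitable direction) a non-zero power of $w$. The word $w$ is polygonal if there exists a closed $w$-polygonal surface $S$ with $\chi(S)<m(S)$. *)

(* Defs.v *)
From HB Require Import structures.
From mathcomp Require Import all_boot all_algebra.
From mathcomp Require Import boolp.

Set Implicit Arguments.
Unset Strict Implicit.
Unset Printing Implicit Defensive.

(* [V2] encodes {1, 2, -1, -2}: the pair (k, false) is +(k + 1) and (k, true)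
   is -(k + 1), for k in {0, 1}.  The same pairs serve as the letters of [F2],
   (k, false) being a_(k+1) and (k, true) its inverse. *)
Notation V2 := ('I_2 * bool)%type.

Definition vabs (x : V2) : 'I_2 := x.1.
Definition vopp (x : V2) : V2 := (x.1, ~~ x.2).

Lemma voppK : involutive vopp.
Proof. by case=> k b; rewrite /vopp /= negbK. Qed.

Lemma vopp_neq x : vopp x != x.
Proof. by case: x => k b; rewrite /vopp xpair_eqE eqxx /=; case: b. Qed.

Definition noncancel : rel V2 := [rel x y | y != vopp x].
Definition reduced (s : seq V2) : bool := sorted noncancel s.

Record F2 := MkF2 { word :> seq V2; wordP : reduced word }.
HB.instance Definition _ := [isSub for word].
HB.instance Definition _ := [Choice of F2 by <:].

Definition push (x : V2) (s : seq V2) : seq V2 :=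
  if s is y :: s' then if y == vopp x then s' else x :: s else [:: x].

Lemma reduced_push x s : reduced s -> reduced (push x s).
Proof.
case: s => [|y s] //= rs; case: ifP => [_|/negbT nyx]; first exact: path_sorted rs.
by apply/andP.
Qed.

Lemma pushK x s : reduced s -> push x (push (vopp x) s) = s.
Proof.
case: s => [|y s] /= rs; first by rewrite eqxx.
rewrite voppK; case: eqP rs => [-> | _ _] /=; last by rewrite eqxx.
by case: s => [|z s] //= /andP[/negPf->].
Qed.

Lemma reduced_foldr_push t s : reduced s -> reduced (foldr push s t).
Proof. by move=> rs; elim: t => //= x t; apply: reduced_push. Qed.

Lemma foldr_push s x t : reduced s ->
  foldr push s (push x t) = push x (foldr push s t).
Proof.
move=> rs; case: t => [|y t] //=; case: eqP => [->|//].
by rewrite pushK // reduced_foldr_push.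
Qed.

Lemma push_reduced u : reduced u -> foldr push [::] u = u.
Proof.
elim: u => //= x u IH ru; rewrite IH; last exact: path_sorted ru.
by case: u ru {IH} => [|y u] //= /andP[/negPf->].
Qed.

Definition F2one : F2 := @MkF2 [::] isT.

Definition F2mul (u v : F2) : F2 := MkF2 (reduced_foldr_push u (wordP v)).

Lemma reduced_inv s : reduced s -> reduced (rev (map vopp s)).
Proof.
rewrite /reduced rev_sorted sorted_map; apply: sub_sorted => x y.
by rewrite /noncancel /relpre /= voppK; apply: contraNneq => ->.
Qed.

Definition F2inv (u : F2) : F2 := MkF2 (reduced_inv (wordP u)).

Lemma F2mulA : associative F2mul.
Proof.
move=> u v w; apply: val_inj => /=; elim: (u : seq V2) => //= x t ->.
by rewrite foldr_push ?wordP.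
Qed.

Lemma F2mul1g : left_id F2one F2mul.
Proof. by move=> u; apply: val_inj. Qed.

Lemma F2mulg1 : right_id F2one F2mul.
Proof. by move=> u; apply: val_inj; apply: push_reduced (wordP u). Qed.

Lemma F2mulVg : left_inverse F2one F2inv F2mul.
Proof.
move=> [s rs]; apply: val_inj => /=; elim: s rs => //= x s IH rs.
by rewrite rev_cons foldr_rcons /= voppK eqxx IH //; exact: path_sorted rs.
Qed.

Lemma F2mulgV : right_inverse F2one F2inv F2mul.
Proof.
move=> u; rewrite -[RHS](F2mulVg (F2inv u)); congr (F2mul _ _).
apply: val_inj => /=; rewrite map_rev revK -map_comp -[LHS]map_id.
by apply: eq_map => x /=; rewrite voppK.
Qed.

HB.instance Definition _ :=
  isGroup.Build F2 F2mulA F2mul1g F2mulg1 F2mulVg F2mulgV.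

Definition gen (k : 'I_2) : F2 := @MkF2 [:: (k, false)] isT.

Definition zpowg (G : groupType) (x : G) (p : int) : G :=
  match p with Posz n => (x ^+ n)%g | Negz n => (x ^- n.+1)%g end.

Definition cyclically_reduced (w : F2) : bool := cycle noncancel w.

Section Cong.
Variables (M : nmodType) (r : M -> M -> Prop).
Local Open Scope ring_scope.

Inductive cong : M -> M -> Prop :=
| cong_base x y : r x y -> cong x y
| cong_refl x : cong x x
| cong_sym x y : cong x y -> cong y x
| cong_trans y x z : cong x y -> cong y z -> cong x z
| cong_add x x' y y' : cong x x' -> cong y y' -> cong (x + y) (x' + y').

Definition congb : rel M := fun x y => `[< cong x y >].

Lemma congb_refl : reflexive congb.
Proof. by move=> x; apply/asboolP/cong_refl. Qed.
Lemma congb_sym : symmetric congb.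
Proof. by move=> x y; apply/asboolP/asboolP; apply: cong_sym. Qed.
Lemma congb_trans : transitive congb.
Proof.
by move=> y x z /asboolP xy /asboolP yz; apply/asboolP/(cong_trans xy yz).
Qed.

Canonical congb_equiv := EquivRel congb congb_refl congb_sym congb_trans.

Local Open Scope quotient_scope.

Definition presented := {eq_quot congb}.
HB.instance Definition _ : EqQuotient _ congb presented := EqQuotient.on presented.
HB.instance Definition _ := Choice.on presented.

Definition presented_add (x y : presented) : presented :=
  \pi_presented (repr x + repr y).

Lemma presented_piD x y :
  presented_add (\pi x) (\pi y) = \pi_presented (x + y).
Proof.
have reprE z : cong (repr (\pi_presented z)) z.
  apply/asboolP; rewrite -/(congb _ _).
  by have := reprK (\pi_presented z); move/eqmodP.
by apply/eqmodP/asboolP/cong_add; apply: reprE.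
Qed.

Lemma presented_addA : associative presented_add.
Proof.
move=> x y z; rewrite -[x]reprK -[y]reprK -[z]reprK.
by rewrite !presented_piD GRing.addrA.
Qed.
Lemma presented_addC : commutative presented_add.
Proof. by move=> x y; rewrite /presented_add GRing.addrC. Qed.
Lemma presented_add0 : left_id (\pi_presented 0) presented_add.
Proof. by move=> x; rewrite -[x]reprK presented_piD GRing.add0r. Qed.

HB.instance Definition _ :=
  GRing.isNmodule.Build presented presented_addA presented_addC presented_add0.

End Cong.

Inductive submonoid_gen (M : nmodType) (X : M -> Prop) : M -> Prop :=
| submonoid_gen_base x : X x -> submonoid_gen X x
| submonoid_gen_0 : submonoid_gen X 0%R
| submonoid_gen_add x y :
    submonoid_gen X x -> submonoid_gen X y -> submonoid_gen X (x + y)%R.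

Definition inE2 : pred (V2 * V2) := [pred e | vabs e.1 != vabs e.2].
Definition E2 := {e : V2 * V2 | inE2 e}.
HB.instance Definition _ := Finite.on E2.

Lemma inE2_bar (e : E2) : inE2 (vopp (val e).2, vopp (val e).1).
Proof. by case: e => -[x y] /= ne; rewrite /inE2 /= /vabs /= eq_sym. Qed.

Definition bar (e : E2) : E2 := Sub _ (inE2_bar e).

(* Multiplicity functions; E_2 being finite, no finite-support condition is
   needed for this to be the free commutative monoid on E_2. *)
Definition A2star := {ffun E2 -> nat}.
HB.instance Definition _ := GRing.Nmodule.on A2star.

Definition basis (e : E2) : A2star := [ffun e' => nat_of_bool (e' == e)].

Definition A2rel (f g : A2star) : Prop :=
  exists e : E2, f = basis e /\ g = basis (bar e).

Definition A2 := presented A2rel.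
HB.instance Definition _ := GRing.Nmodule.on A2.

(* The class of the generator (i, j); it is 0, a junk value, when (i, j) is
   not in E_2. *)
Definition A2gen (i j : V2) : A2 :=
  if insub (i, j) is Some e then (\pi_A2 (basis e))%qT else 0%R.

Definition is_simple_cycle (x : A2) : Prop :=
  exists (r : nat) (c : 'I_r -> V2),
    [/\ 0 < r, injective c, (forall i, inE2 (c i, c (ordS i)))
      & x = (\sum_(i < r) A2gen (c i) (c (ordS i)))%R].

Definition T2 : A2 -> Prop := submonoid_gen is_simple_cycle.

(* sign(p) k, for p nonzero *)
Definition signed (p : int) (k : 'I_2) : V2 := (k, (p < 0)%R).

Definition rho (l : nat) (k : 'I_l -> 'I_2) (p : 'I_l -> int) : A2 :=
  (\sum_(i < l)
     A2gen (signed (p i) (k i)) (signed (p (ordS i)) (k (ordS i))))%R.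

Section FinQuot.
Variables (T : finType) (r : rel T).
Local Open Scope quotient_scope.

Definition eqclos : rel T := connect [rel x y | r x y || r y x].

Lemma eqclos_refl : reflexive eqclos.
Proof. exact: connect0. Qed.
Lemma eqclos_sym : symmetric eqclos.
Proof. by apply: sym_connect_sym => x y /=; rewrite orbC. Qed.
Lemma eqclos_trans : transitive eqclos.
Proof. exact: connect_trans. Qed.

Canonical eqclos_equiv := EquivRel eqclos eqclos_refl eqclos_sym eqclos_trans.

Definition finquot := {eq_quot eqclos}.
HB.instance Definition _ : EqQuotient _ eqclos finquot := EqQuotient.on finquot.
HB.instance Definition _ := Countable.on finquot.
HB.instance Definition _ : isFinite finquot := CanIsFinite (@reprK _ finquot).

End FinQuot.

(* A finite 1-dimensional CW-complex is encoded by its vertices and its darts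
   (oriented edges); [org] is the initial vertex and [drev] reverses a dart.
   An edge is an orbit of [drev], and a graph map is determined, up to
   reparametrizing edges, by its action on vertices and darts. *)
Record graph := Graph {
  vert : finType;
  dart : finType;
  org : dart -> vert;
  drev : dart -> dart;
  drevK : involutive drev;
  drev_neq : forall d, drev d != d }.

Arguments org {g}.
Arguments drev {g}.

Definition edge (G : graph) : finType := finquot (frel (@drev G)).

Record gmap (G H : graph) := GMap {
  onvert : vert G -> vert H;
  ondart :> dart G -> dart H;
  ondart_org : forall d, onvert (org d) = org (ondart d);
  ondart_rev : forall d, ondart (drev d) = drev (ondart d) }.

(* Local injectivity: the darts issuing from a vertex form its link. *)
Definition immersion (G H : graph) (f : gmap G H) : Prop :=
  forall d d' : dart G, org d = org d' -> f d = f d' -> d = d'.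

Section Comp.
Variables (G H K : graph) (g : gmap H K) (f : gmap G H).

Lemma gcomp_org d : onvert g (onvert f (org d)) = org (g (f d)).
Proof. by rewrite !ondart_org. Qed.
Lemma gcomp_rev d : g (f (drev d)) = drev (g (f d)).
Proof. by rewrite !ondart_rev. Qed.

Definition gcomp : gmap G K :=
  @GMap G K (onvert g \o onvert f) (g \o f) gcomp_org gcomp_rev.

End Comp.

(* The bouquet of two circles; its dart (k, false) is the loop labeled
   a_(k+1), traversed positively. *)
Definition rose : graph := @Graph unit V2 (fun=> tt) vopp voppK vopp_neq.

Lemma flipK n : involutive (fun d : 'I_n * bool => (d.1, ~~ d.2)).
Proof. by case=> i b /=; rewrite negbK. Qed.
Lemma flip_neq n (d : 'I_n * bool) : (d.1, ~~ d.2) != d.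
Proof. by case: d => i b; rewrite xpair_eqE eqxx /=; case: b. Qed.

(* The boundary of an n-gon: the side i joins the corners i and i + 1 mod n,
   and is traversed from i to i + 1 by the dart (i, false). *)
Definition circle (n : nat) : graph :=
  @Graph 'I_n ('I_n * bool)%type
    (fun d => if d.2 then ordS d.1 else d.1)
    (fun d => (d.1, ~~ d.2)) (@flipK n) (@flip_neq n).

(* The dart following [d] when going around the polygon in the direction of
   [d]. *)
Definition next_dart n (d : dart (circle n)) : dart (circle n) :=
  (if d.2 then ord_pred d.1 else ordS d.1, d.2).

Definition reads n (f : gmap (circle n) rose) (u : F2) : Prop :=
  exists d : dart (circle n), map f (traject (@next_dart n) d n) = u.

Section Sum.
Variables (I : finType) (G : I -> graph).

Definition gsum_org (d : {i : I & dart (G i)}) : {i : I & vert (G i)} :=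
  Tagged (fun i => vert (G i)) (org (tagged d)).
Definition gsum_rev (d : {i : I & dart (G i)}) : {i : I & dart (G i)} :=
  Tagged (fun i => dart (G i)) (drev (tagged d)).

Lemma gsum_revK : involutive gsum_rev.
Proof. by case=> i d; rewrite /gsum_rev /= drevK. Qed.
Lemma gsum_rev_neq d : gsum_rev d != d.
Proof. by case: d => i d; rewrite eq_Tagged /= drev_neq. Qed.

Definition gsum : graph :=
  @Graph {i : I & vert (G i)} {i : I & dart (G i)} gsum_org gsum_rev
    gsum_revK gsum_rev_neq.

Definition gsum_in (i : I) : gmap (G i) gsum :=
  @GMap (G i) gsum (Tagged (fun i => vert (G i))) (Tagged (fun i => dart (G i)))
    (fun=> erefl) (fun=> erefl).

End Sum.

(* A partition of the edges of [G] into pairs, with a homeomorphism within each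
   pair: [glue d] is the image of the oriented edge [d] in the other edge of
   its class. *)
Record side_pairing (G : graph) := SidePairing {
  glue : dart G -> dart G;
  glueK : involutive glue;
  glue_rev : forall d, glue (drev d) = drev (glue d);
  glue_neq : forall d, glue d != d;
  glue_neq_rev : forall d, glue d != drev d }.

Section Glue.
Variables (G : graph) (s : side_pairing G).
Local Open Scope quotient_scope.

Definition glue_dart_rel : rel (dart G) := frel (glue s).
(* The vertices of the glued graph are the classes of the equivalence relation
   generated by identifying corresponding ends of paired edges; both ends are
   covered since [d] ranges over the two orientations of each edge. *)
Definition glue_vert_rel : rel (vert G) :=
  [rel x y | [exists d, (x == org d) && (y == org (glue s d))]].

Definition qdart : finType := finquot glue_dart_rel.
Definition qvert : finType := finquot glue_vert_rel.
Definition to_qdart (d : dart G) : qdart := \pi_(finquot glue_dart_rel) d.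
Definition to_qvert (x : vert G) : qvert := \pi_(finquot glue_vert_rel) x.

Definition qorg (d : qdart) : qvert :=
  to_qvert (org (repr (d : finquot glue_dart_rel))).
Definition qrev (d : qdart) : qdart :=
  to_qdart (drev (repr (d : finquot glue_dart_rel))).

Lemma eqclos_glue d d' :
  eqclos glue_dart_rel d d' -> d' = d \/ d' = glue s d.
Proof.
case/connectP=> t; elim: t d => [|e t IH] d /=; first by left.
case/andP=> de /IH{}IH /IH.
have -> : e = glue s d.
  by case/orP: de => /eqP <- //; rewrite glueK.
by rewrite glueK; case=> ->; [right | left].
Qed.

Lemma to_qdart_glue d : to_qdart (glue s d) = to_qdart d.
Proof. by apply/eqmodP/connect1 => /=; rewrite /glue_dart_rel /= eqxx orbT. Qed.

Lemma to_qvert_glue d : to_qvert (org (glue s d)) = to_qvert (org d).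
Proof.
apply/eqmodP/connect1 => /=; apply/orP; right; apply/existsP; exists d.
by rewrite !eqxx.
Qed.

Lemma repr_to_qdart d :
  repr (to_qdart d : finquot glue_dart_rel) = d \/
  repr (to_qdart d : finquot glue_dart_rel) = glue s d.
Proof.
by apply: eqclos_glue; rewrite eqclos_sym; apply/eqmodP; rewrite reprK.
Qed.

Lemma qorgE d : to_qvert (org d) = qorg (to_qdart d).
Proof. by rewrite /qorg; case: (repr_to_qdart d) => ->; rewrite ?to_qvert_glue. Qed.

Lemma qrevE d : to_qdart (drev d) = qrev (to_qdart d).
Proof.
by rewrite /qrev; case: (repr_to_qdart d) => ->; rewrite -?glue_rev ?to_qdart_glue.
Qed.

Lemma qrevK : involutive qrev.
Proof.
move=> d; rewrite -[d](reprK (d : finquot glue_dart_rel)) -/(to_qdart _).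
by rewrite -!qrevE drevK.
Qed.

Lemma qrev_neq d : qrev d != d.
Proof.
rewrite -[d](reprK (d : finquot glue_dart_rel)) -/(to_qdart _) -qrevE.
set e := repr _; apply/eqP => /eqmodP /eqclos_glue[] eE.
  by have := drev_neq e; rewrite -eE eqxx.
by have := glue_neq_rev s (drev e); rewrite -eE drevK eqxx.
Qed.

Definition glued : graph := @Graph qvert qdart qorg qrev qrevK qrev_neq.

Definition glued_proj : gmap G glued := @GMap G glued to_qvert to_qdart qorgE qrevE.

End Glue.

(* Polygonal disks [P_i], i < [ncells], where [P_i] has [nsides i] sides,
   together with a side-pairing. *)
Record polygonal_surface := PolygonalSurface {
  ncells : nat;
  nsides : 'I_ncells -> nat;
  nsides_gt0 : forall i, 0 < nsides i;
  pairing : side_pairing (gsum (fun i => circle (nsides i))) }.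

Definition skeleton (S : polygonal_surface) : graph := glued (pairing S).

Definition attach (S : polygonal_surface) (i : 'I_(ncells S)) :
    gmap (circle (nsides i)) (skeleton S) :=
  gcomp (glued_proj (pairing S)) (gsum_in (fun i => circle (nsides i)) i).

Definition euler_char (S : polygonal_surface) : int :=
  (#|vert (skeleton S)|%:Z - #|edge (skeleton S)|%:Z + (ncells S)%:Z)%R.

(* [reads] allows an arbitrary starting corner and both directions, and goes
   around the boundary exactly once. *)
Definition w_polygonal (w : F2) (S : polygonal_surface) : Prop :=
  exists phi : gmap (skeleton S) rose,
    immersion phi /\
    forall i : 'I_(ncells S),
      immersion (gcomp phi (attach i)) /\
      exists q : int, q <> 0%R /\ reads (gcomp phi (attach i)) (zpowg w q).

(* Polygonality is only defined for cyclically reduced words, whence the first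
   conjunct. *)
Definition polygonal (w : F2) : Prop :=
  cyclically_reduced w /\
  exists S : polygonal_surface,
    w_polygonal w S /\ (euler_char S < (ncells S)%:Z)%R.

(* Main.v *)
(* Write [x, y] for a corner of [w] that enters along the letter x and leaves
   along y; read backwards it is a corner [-y, -x].  Counting, in both reading
   directions, the letters x that are followed, resp. preceded, by x, y or -y
   shows that for |x| <> |y| there are as many corners [x, y] as [y, x].  This
   gives [rho w] as a sum of cycles (x, y) + (y, x).  It also gives an
   involution on the corners of [w] exchanging [x, y] and [y, x]; sending the
   side s labeled x to the side following the partner of the corner at the end
   of s is a label-preserving permutation sigma of the sides, equal to
   "next side" inside each power of a generator.

   Take two copies of the polygon reading [w] and glue each positively read
   side s of copy 0 to sigma s in copy 1.  As no generator is isolated, a corner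
   between two powers in one copy always meets corners inside a power of the
   other copy, so a vertex is either formed by two corners [x, x], or by four
   corners [x, y], [y, y], [y, x], [x, x].  In both cases the darts at the
   vertex carry distinct labels, and vertices of the second kind, of degree 4,
   make the Euler characteristic of the 1-skeleton negative. *)
Require Import Defs.
From mathcomp Require Import all_boot all_algebra zify.
From mathcomp Require Import boolp.

Set Implicit Arguments.
Unset Strict Implicit.
Unset Printing Implicit Defensive.

(** * Letters and their inverses *)

Lemma noncancel_same_gen (x y : V2) : (x.1 == y.1) -> y != vopp x -> y = x.
Proof.
case: x y => [k b] [k' b'] /= /eqP <-.
by rewrite xpair_eqE eqxx /=; case: b b' => -[].
Qed.

Lemma sum_pm_eq1 (x y z : V2) : x.1 != y.1 ->
  (z == x) + (z == vopp x) + (z == y) + (z == vopp y) = 1.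
Proof.
by move: x y z => [[[|[|//]] ?] []] [[[|[|//]] ?] []] [[[|[|//]] ?] []].
Qed.

Lemma ord2_neq (i j : 'I_2) : i != j -> (j == ord0) = (i != ord0).
Proof. by move: i j => [[|[|//]] ?] [[|[|//]] ?]. Qed.

Lemma vopp_inj : injective vopp.
Proof. exact: inv_inj voppK. Qed.

Lemma noncancel_refl : reflexive noncancel.
Proof. by move=> x; rewrite /noncancel /= eq_sym vopp_neq. Qed.

(** * Darts and corners of a labelled polygon *)

Section Turns.
Variable n : nat.
Notation D := (dart (circle n)).
Implicit Types d e : D.

(** A dart stands for the corner at its end, between it and [next_dart d]; [turn d] stands for the
    same corner read backwards. In contrast, [other] is the second dart issuing from the origin of
    d. *)
Definition turn d : D := drev (next_dart d).
Definition other d : D := next_dart (drev d).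

Lemma turnK : involutive turn.
Proof. by case=> i []; rewrite /turn /next_dart /= ?ordSK ?ord_predK. Qed.

Lemma otherK : involutive other.
Proof. by case=> i []; rewrite /other /next_dart /= ?ordSK ?ord_predK. Qed.

Lemma org_other d : org (other d) = org d.
Proof. by case: d => i [] //=; rewrite ord_predK. Qed.

Lemma eq_org d e : org d = org e -> e = d \/ e = other d.
Proof.
case: d e => [i b] [j b']; rewrite /other /next_dart /=.
case: b b' => -[] /= ij; [left|right|right|left]; rewrite ?ij ?ordSK //.
by rewrite (can_inj (@ordSK n) ij).
Qed.

Lemma next_dartE d : next_dart d = drev (turn d).
Proof. by rewrite /turn drevK. Qed.

Lemma next_dart_inj : injective (@next_dart n).
Proof. by move=> d e /(congr1 drev) /(can_inj turnK). Qed.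

Definition prev_dart d : D := turn (drev d).

Lemma prev_dartK : cancel prev_dart (@next_dart n).
Proof. by move=> d; rewrite next_dartE turnK drevK. Qed.

Lemma next_dartK : cancel (@next_dart n) prev_dart.
Proof. by move=> d; rewrite /prev_dart next_dartE drevK turnK. Qed.

Lemma other_next d : other (next_dart d) = drev d.
Proof. by rewrite /other -[drev _]/(turn d) next_dartE turnK. Qed.

Lemma other_rev d : other (drev d) = next_dart d.
Proof. by rewrite /other drevK. Qed.

Variable c : 'I_n -> V2.

Definition label d : V2 := if d.2 then vopp (c d.1) else c d.1.

Lemma label_rev d : label (drev d) = vopp (label d).
Proof. by case: d => i []; rewrite /label /= ?voppK. Qed.

Definition cyc_noncancel := forall i, noncancel (c i) (c (ordS i)).
Definition no_isolated := forall i, c i = c (ord_pred i) \/ c i = c (ordS i).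

Hypothesis cN : cyc_noncancel.

Lemma label_next d : label (next_dart d) != vopp (label d).
Proof.
case: d => i []; rewrite /label /=; last exact: cN.
rewrite (inj_eq vopp_inj) -[X in _ != vopp (c X)]ord_predK eq_sym.
by rewrite -(inj_eq vopp_inj) voppK; apply: cN.
Qed.

Lemma label_next_eq d :
  ((label d).1 == (label (next_dart d)).1) = (label (next_dart d) == label d).
Proof.
by apply/idP/eqP => [/noncancel_same_gen ->| ->] //; apply: label_next.
Qed.

Lemma label_other d : label (other d) != label d.
Proof. by have := label_next (drev d); rewrite label_rev voppK. Qed.

Lemma label_turn d : label (turn d) = vopp (label (next_dart d)).
Proof. by rewrite label_rev. Qed.

Lemma label_next_turn d : label (next_dart (turn d)) = vopp (label d).
Proof. by rewrite next_dartE turnK label_rev. Qed.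

Local Arguments drev : simpl never.
Local Arguments next_dart : simpl never.

(** * Counting the corners by label and pairing them *)

Definition corners x y := \sum_d ((label d == x) && (label (next_dart d) == y)).

Lemma cornersE x y :
  corners x y = #|[pred d | (label d == x) && (label (next_dart d) == y)]|.
Proof. by rewrite -sum1_card big_mkcond. Qed.

Lemma corners_turn x y : corners (vopp y) (vopp x) = corners x y.
Proof.
rewrite /corners (reindex_inj (can_inj turnK)) /=; apply: eq_bigr => d _.
by rewrite label_turn label_next_turn !(inj_eq vopp_inj) andbC.
Qed.

(** After adding [corners x x], both sides count the darts labelled x, sorted by successor on the
    left and by predecessor on the right; the neighbour -x is excluded by [cN]. *)
Lemma corners_balance x y : x.1 != y.1 ->
  corners x y + corners x (vopp y) = corners y x + corners (vopp y) x.
Proof.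
move=> xy.
have out : \sum_d (label d == x) = corners x x + corners x y + corners x (vopp y).
  rewrite /corners -!big_split; apply: eq_bigr => d _ /=.
  case: eqP => //= dx; have := sum_pm_eq1 (label (next_dart d)) xy.
  by move: (label_next d); rewrite dx => /negPf ->; lia.
have inn : \sum_d (label d == x) = corners x x + corners y x + corners (vopp y) x.
  rewrite (reindex_inj next_dart_inj) /corners -!big_split; apply: eq_bigr => d _ /=.
  case: (label (next_dart d) =P x) => dx; rewrite ?andbT ?andbF //.
  have := sum_pm_eq1 (label d) xy.
  by move: (label_next d); rewrite dx -(inj_eq vopp_inj) voppK eq_sym => /negPf ->; lia.
lia.
Qed.

(** Put A = [x, y], B = [y, x], P = [x, -y] = [y, -x] and Q = [-y, x] = [-x, y], the equalities
    coming from reversal. The balances for (x, y) and (y, x) read A + P = B + Q and B + P = A + Q,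
    whence A = B. *)
Lemma cornersC x y : x.1 != y.1 -> corners x y = corners y x.
Proof.
move=> xy; have := corners_balance xy.
have yx : y.1 != x.1 by rewrite eq_sym.
have := corners_balance yx.
rewrite -(corners_turn x (vopp y)) -(corners_turn (vopp x) y) !voppK; lia.
Qed.

(* Listing the corners [-y, -x] as the reversed corners [x, y], in the same
   order, makes [swap] below commute with reversal. *)
Definition corner_seq (x y : V2) : seq D :=
  let s x y := [seq d <- enum D | (label d == x) && (label (next_dart d) == y)] in
  if x.1 == ord0 then s x y else map turn (s (vopp y) (vopp x)).

Lemma mem_corner_seq x y d :
  (d \in corner_seq x y) = (label d == x) && (label (next_dart d) == y).
Proof.
rewrite /corner_seq; case: ifP => _; first by rewrite mem_filter mem_enum andbT.
rewrite -[d]turnK (mem_map (can_inj turnK)) mem_filter mem_enum andbT turnK.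
by rewrite label_turn label_next_turn !(inj_eq vopp_inj) andbC.
Qed.

Lemma uniq_corner_seq x y : uniq (corner_seq x y).
Proof.
rewrite /corner_seq; case: ifP => _; first exact/filter_uniq/enum_uniq.
by rewrite (map_inj_uniq (can_inj turnK)); apply/filter_uniq/enum_uniq.
Qed.

Lemma size_corner_seq x y : size (corner_seq x y) = corners x y.
Proof.
rewrite cornersE -(card_uniqP (uniq_corner_seq x y)); apply: eq_card => d.
exact: mem_corner_seq.
Qed.

(** Exactly one of |x| and |y| is the first generator, so exactly one of the two lists is defined as
    the reversal of the other. *)
Lemma corner_seq_turn x y : x.1 != y.1 ->
  corner_seq (vopp y) (vopp x) = map turn (corner_seq x y).
Proof.
move=> xy; rewrite /corner_seq /= !voppK (ord2_neq xy).
by case: eqP => //= _; rewrite -map_comp map_id_in // => d _ /=; rewrite turnK.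
Qed.

(** Corners [x, y] and [y, x] are matched by their rank in the two lists. These have equal length by
    [cornersC], so the default of [nth] is never returned. *)
Definition swap d : D :=
  let x := label d in let y := label (next_dart d) in
  if x.1 == y.1 then d else nth d (corner_seq y x) (index d (corner_seq x y)).

Lemma swap_mem d : (label d).1 != (label (next_dart d)).1 ->
  swap d \in corner_seq (label (next_dart d)) (label d).
Proof.
move=> xy; rewrite /swap (negPf xy) mem_nth // size_corner_seq.
by rewrite -cornersC // -size_corner_seq index_mem mem_corner_seq !eqxx.
Qed.

Lemma label_swap d : label (swap d) = label (next_dart d).
Proof.
case: (boolP ((label d).1 == (label (next_dart d)).1)) => xy.
  by rewrite /swap xy; move: xy; rewrite label_next_eq => /eqP.
by move: (swap_mem xy); rewrite mem_corner_seq => /andP[/eqP].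
Qed.

Lemma label_next_swap d : label (next_dart (swap d)) = label d.
Proof.
case: (boolP ((label d).1 == (label (next_dart d)).1)) => xy.
  by rewrite /swap xy; move: xy; rewrite label_next_eq => /eqP.
by move: (swap_mem xy); rewrite mem_corner_seq => /andP[_ /eqP].
Qed.

Lemma swapK : involutive swap.
Proof.
move=> d; rewrite {1}/swap label_swap label_next_swap eq_sym.
case: ifP => xy; first by rewrite /swap xy.
have dL : d \in corner_seq (label d) (label (next_dart d)).
  by rewrite mem_corner_seq !eqxx.
rewrite {2}/swap xy index_uniq ?uniq_corner_seq //; last first.
  rewrite size_corner_seq -cornersC ?xy // -size_corner_seq index_mem //.
by rewrite (set_nth_default d) ?nth_index // index_mem.
Qed.

Lemma swap_turn d : swap (turn d) = turn (swap d).
Proof.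
rewrite /swap label_turn label_next_turn /= eq_sym.
case: ifPn => // xy; have yx := xy; rewrite eq_sym in yx.
rewrite !corner_seq_turn // index_map; last exact: can_inj turnK.
rewrite (nth_map d) // size_corner_seq -cornersC // -size_corner_seq.
by rewrite index_mem mem_corner_seq !eqxx.
Qed.

Lemma swap_id d : label (next_dart d) = label d -> swap d = d.
Proof. by rewrite /swap => ->; rewrite eqxx. Qed.

(** * The gluing map between the copies and the links of vertices *)

Hypothesis cI : no_isolated.

Lemma label_noniso d : label (next_dart d) != label d ->
  label (next_dart (next_dart d)) = label (next_dart d).
Proof.
case: d => i []; rewrite /label /next_dart /=.
  by case: (cI (ord_pred i)) => ->; rewrite ?ord_predK ?eqxx.
by case: (cI (ordS i)) => ->; rewrite ?ordSK ?eqxx.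
Qed.

Definition shift (s : bool) d : D :=
  if s then next_dart (swap d) else swap (prev_dart d).

(* The gluing map from copy [b] of the polygon to the other copy: [shift true]
   is sigma and [shift false] its inverse, the latter being applied when the
   dart is read negatively in copy 0 or positively in copy 1. *)
Definition cross (b : bool) d : D := shift (b == (label d).2) d.

Lemma label_prev d : label (next_dart d) != label d ->
  label (prev_dart d) = label d.
Proof.
move=> dn; apply/eqP/negPn/negP => pd; move: dn.
by rewrite -[d]prev_dartK label_noniso ?eqxx // prev_dartK eq_sym.
Qed.

Lemma shiftK s : cancel (shift s) (shift (~~ s)).
Proof.
by move=> d; case: s; rewrite /shift /= ?next_dartK swapK ?prev_dartK.
Qed.

Lemma shift_rev s d : shift s (drev d) = drev (shift (~~ s) d).
Proof.
case: s; rewrite /shift /prev_dart /= ?drevK; last exact: swap_turn.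
by rewrite next_dartE -swap_turn.
Qed.

Lemma label_shift s d : label (shift s d) = label d.
Proof.
case: s; rewrite /shift /= ?label_next_swap // label_swap.
by rewrite prev_dartK.
Qed.

Lemma label_cross b d : label (cross b d) = label d.
Proof. exact: label_shift. Qed.

Lemma crossK b d : cross (~~ b) (cross b d) = d.
Proof.
rewrite {1}/cross label_cross /cross.
have -> : (~~ b == (label d).2) = ~~ (b == (label d).2) by case: b (_.2) => -[].
exact: shiftK.
Qed.

(** Reversal exchanges sigma with its inverse, and also flips the sign by which [cross] chooses
    between them; the two effects cancel. *)
Lemma cross_rev b d : cross b (drev d) = drev (cross b d).
Proof.
rewrite /cross label_rev shift_rev /=; congr (drev (shift _ _)).
by case: b (label d) => [] [? []].
Qed.


Lemma cross_pos b d : b == (label d).2 -> cross b d = next_dart (swap d).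
Proof. by rewrite /cross => ->. Qed.

Lemma cross_neg b d : b != (label d).2 -> cross b d = swap (prev_dart d).
Proof. by rewrite /cross => /negPf ->. Qed.

(** This is [cross_link] below for the dart [next_dart d], in the case where [cross b] acts on that
    dart by sigma, written without reversals. *)
Lemma cross_link_pos b d : b == (label (next_dart d)).2 ->
  let e := next_dart (cross b d) in
  cross (~~ b) e = next_dart (cross (~~ b) (swap (next_dart d))) /\
  (label e != label (next_dart d) \/ e = cross b (next_dart d)).
Proof.
move=> bd; set f := next_dart d in bd *; rewrite /= (cross_pos bd).
case: (eqVneq (label f) (label d)) => [fd|fd].
  have -> : cross b d = f by rewrite cross_pos -?fd // swap_id.
  have [ff|ff] := eqVneq (label (next_dart f)) (label f).
    have sf := swap_id ff; rewrite sf; split; last by right.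
    have {1}-> : next_dart f = cross b f by rewrite (cross_pos bd) sf.
    rewrite crossK; have {2}-> : f = cross b d by rewrite cross_pos -?fd // swap_id.
    by rewrite crossK.
  split; last by left.
  (* The sign of the letter after the turn decides between sigma and its inverse. Both sides are
     then computed from the fact that the corners next to a turn are fixed by [swap]. *)
  case: (boolP (~~ b == (label (next_dart f)).2)) => bn.
    rewrite !cross_pos ?label_swap // swapK swap_id // label_noniso //.
  rewrite !cross_neg ?label_swap // next_dartK [swap (prev_dart _)]swap_id prev_dartK //.
  by rewrite label_prev // label_swap label_next_swap eq_sym.
(* Here the letter changes at the end of d, so the next corner lies inside a power. *)
have sf : swap f = f by apply: swap_id; rewrite label_noniso.
have bf : ~~ b != (label f).2 by rewrite -(eqP bd); case: (b).
rewrite sf (cross_neg bf) next_dartK.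
case: (boolP (b == (label d).2)) => bd'.
  have ns : label (next_dart (next_dart (swap d))) = label (next_dart (swap d)).
    by apply: label_noniso; rewrite label_next_swap label_swap eq_sym.
  rewrite (cross_pos bd') ns label_next_swap eq_sym; split; last by left.
  rewrite cross_neg; first by rewrite next_dartK swap_id.
  by rewrite ns label_next_swap -(eqP bd'); case: (b).
have pd : label (prev_dart d) = label d by apply: label_prev.
have sp : swap (prev_dart d) = prev_dart d by rewrite swap_id // prev_dartK.
rewrite (cross_neg bd') sp prev_dartK eq_sym; split; last by left.
by rewrite cross_pos //; move: bd'; case: (b) (_.2) => -[].
Qed.

(* Going around a vertex by alternating [other] and [cross] closes up after at
   most four corners, and the dart facing [d] has a new label unless the vertex
   has degree 2. *)
Lemma cross_link b d :
  let e := other (cross b (other d)) in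
  cross (~~ b) e = other (cross (~~ b) (other (cross b d))) /\
  (label e != label d \/ e = cross b d).
Proof.
have pos b' d' : b' == (label d').2 ->
  let e := other (cross b' (other d')) in
  cross (~~ b') e = other (cross (~~ b') (other (cross b' d'))) /\
  (label e != label d' \/ e = cross b' d').
  rewrite -[d']prev_dartK => bd; have := cross_link_pos bd.
  by rewrite /= (cross_pos bd) !other_next !cross_rev !other_rev.
case: (boolP (b == (label d).2)) => bd; first exact: pos.
(* Otherwise the same vertex is read from the partner [cross b d], which has the same label but lies
   in the other copy. *)
have /pos[/=] : ~~ b == (label (cross b d)).2.
  by rewrite label_cross; case: b (_.2) bd => -[].
rewrite negbK crossK label_cross => -[link ends].
rewrite -link crossK label_cross; split=> //.
by case: ends => [? | ->]; [left | right].
Qed.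

End Turns.

(** * Degrees and edges of a finite graph *)

Lemma card_dart_le (G : graph) : #|dart G| <= (#|edge G|).*2.
Proof.
(* A dart is determined by its edge and by whether it is the chosen representative of that edge. *)
pose f (d : dart G) : edge G * bool :=
  let e := (\pi_(finquot (frel (@drev G))) d)%qT in (e, repr e == d).
rewrite -muln2 -card_bool -card_prod; apply: (@leq_card _ _ f) => d e [de].
have cls x : repr (\pi_(finquot (frel (@drev G))) x)%qT = x \/
             repr (\pi_(finquot (frel (@drev G))) x)%qT = drev x.
  have : eqclos (frel (@drev G)) x (repr (\pi_(finquot (frel (@drev G))) x)%qT).
    by rewrite eqclos_sym; apply/eqmodP; rewrite reprK.
  case/connectP=> t; move: (repr _) => y; elim: t x => [|z t IH] x /=.
    by move=> _ ->; left.
  case/andP=> xz /IH{}IH /IH.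
  have -> : z = drev x by case/orP: xz => /eqP <- //; rewrite drevK.
  by rewrite drevK; case=> ->; [right | left].
have := cls e; have := cls d; rewrite de; case=> [-> |rd].
  by rewrite eqxx => _ /esym/eqP.
rewrite rd [_ == d](negPf (drev_neq d)) -rd; case=> [-> |].
  by rewrite eqxx.
by rewrite rd => /(can_inj (@drevK G)).
Qed.

(** Handshake count: the degrees add up to the number of darts, at most twice the number of
    edges. *)
Lemma card_vert_lt_edge (G : graph) (v0 : vert G) :
  (forall v : vert G, 1 < #|[pred d | org d == v]|) ->
  2 < #|[pred d | org d == v0]| -> #|vert G| < #|edge G|.
Proof.
move=> ge2 gt2; rewrite -ltn_double; apply: leq_trans (card_dart_le G).
have -> : #|dart G| = \sum_v #|[pred d : dart G | org d == v]|.
  rewrite -sum1_card (partition_big (@org G) predT) //=.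
  by apply: eq_bigr => v _; rewrite sum1_card.
rewrite -muln2 -sum_nat_const (bigD1 v0) // [leqRHS](bigD1 v0) //= -addSn.
by rewrite leq_add // leq_sum.
Qed.

(** * The closed surface glued from two disks *)

Lemma labels_traject n (c : 'I_n -> V2) (n_gt0 : 0 < n) :
  map (label c) (traject (@next_dart n) (Ordinal n_gt0, false) n)
  = [seq c j | j <- enum 'I_n].
Proof.
pose j0 := Ordinal n_gt0.
apply: (@eq_from_nth _ (c j0)) => [|j].
  by rewrite 2!size_map size_traject size_enum_ord.
rewrite size_map size_traject => jn.
rewrite (nth_map (j0, false)) ?size_traject // nth_traject //.
rewrite (nth_map j0) ?size_enum_ord //.
have -> : iter j (@next_dart n) (j0, false) = (Ordinal jn, false).
  elim: j jn => [|j IH] jn /=; first by congr (_, _); apply: val_inj.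
  rewrite (IH (ltnW jn)) /next_dart /=; congr (_, _); apply: val_inj => /=.
  by rewrite modn_small.
by rewrite /label /=; congr (c _); apply: val_inj; rewrite /= nth_enum_ord.
Qed.

Section Surface.
Variables (n : nat) (c : 'I_n -> V2).
Hypotheses (n_gt0 : 0 < n) (cN : cyc_noncancel c) (cI : no_isolated c).

Definition two_disks : graph := gsum (fun _ : 'I_2 => circle n).
Notation D := (dart two_disks).
Implicit Types d e : D.

Definition on_copy (i : 'I_2) (d : dart (circle n)) : D :=
  @Tagged _ i (fun _ => dart (circle n)) d.

(** [rev_ord] exchanges the two copies, and [odd] turns the index of a copy into the boolean
    expected by [cross]. *)
Definition copy_glue d : D :=
  on_copy (rev_ord (tag d)) (cross c (odd (tag d)) (tagged d)).
Definition copy_other d : D := on_copy (tag d) (other (tagged d)).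
Definition copy_label d : V2 := label c (tagged d).

Lemma odd_rev_ord2 (i : 'I_2) : odd (rev_ord i) = ~~ odd i.
Proof. by case: i => [[|[|]]]. Qed.

Lemma rev_ord2_neq (i : 'I_2) : rev_ord i != i.
Proof. by case: i => [[|[|]]]. Qed.

Lemma copy_glueK : involutive copy_glue.
Proof.
by case=> i d; rewrite /copy_glue /= rev_ordK odd_rev_ord2 crossK.
Qed.

Lemma copy_glue_rev d : copy_glue (drev d) = drev (copy_glue d).
Proof. by case: d => i d; rewrite /copy_glue /= cross_rev. Qed.

Lemma copy_glue_neq d : copy_glue d != d.
Proof. by apply/eqP => /(congr1 tag) /= /eqP; apply/negP/rev_ord2_neq. Qed.

Lemma copy_glue_neq_rev d : copy_glue d != drev d.
Proof. by apply/eqP => /(congr1 tag) /= /eqP; apply/negP/rev_ord2_neq. Qed.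

Definition copy_pairing : side_pairing two_disks :=
  SidePairing copy_glueK copy_glue_rev copy_glue_neq copy_glue_neq_rev.

Definition double : polygonal_surface :=
  @PolygonalSurface 2 (fun _ => n) (fun _ => n_gt0) copy_pairing.

Lemma copy_label_glue d : copy_label (copy_glue d) = copy_label d.
Proof. exact: label_cross. Qed.

Lemma copy_label_rev d : copy_label (drev d) = vopp (copy_label d).
Proof. exact: label_rev. Qed.

Lemma copy_label_other d : copy_label (copy_other d) != copy_label d.
Proof. exact: label_other. Qed.

Lemma copy_otherK : involutive copy_other.
Proof. by case=> i d; rewrite /copy_other /= otherK. Qed.

Lemma copy_link d : let e := copy_other (copy_glue (copy_other d)) in
  copy_glue e = copy_other (copy_glue (copy_other (copy_glue d))) /\
  (copy_label e != copy_label d \/ e = copy_glue d).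
Proof.
case: d => i d; have [link ends] := cross_link cN cI (odd i) d.
rewrite /copy_glue /copy_other /= odd_rev_ord2 rev_ordK link; split=> //.
by case: ends => [? | ->]; [left | right].
Qed.

Lemma copy_eq_org d e : org d = org e -> e = d \/ e = copy_other d.
Proof.
case: d e => i d [j e] /= de; have ij : i = j := congr1 tag de.
move: e de; rewrite -{}ij => e /eqP; rewrite eq_Tagged /= => /eqP /eq_org.
by case=> ->; [left | right].
Qed.

Lemma copy_org_other d : org (copy_other d) = org d.
Proof.
by case: d => i d; apply: (congr1 (@Tagged _ i (fun=> 'I_n)) (org_other d)).
Qed.

(** The orbit of d under the involutions o and g. By [copy_link] they satisfy gogo = ogog, so the
    eight words of the dihedral group of order 8 suffice. *)
Definition star d : seq D :=
  let o := copy_other in let g := copy_glue in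
  [:: d; g d; o d; o (g d); g (o d); g (o (g d)); o (g (o d)); o (g (o (g d)))].

Lemma star_glue d e : e \in star d -> copy_glue e \in star d.
Proof.
have [link _] := copy_link d; rewrite !inE; do 7?[case/orP=> [/eqP ->|]]; last move=> /eqP ->.
all: rewrite -?link ?copy_glueK ?link ?eqxx ?orbT //.
Qed.

Lemma star_other d e : e \in star d -> copy_other e \in star d.
Proof.
rewrite !inE; do 7?[case/orP=> [/eqP ->|]]; last move=> /eqP ->.
all: rewrite ?copy_otherK ?eqxx ?orbT //.
Qed.

(** Gluing preserves labels and [copy_other] changes them, which excludes the four middle darts of
    the list. The last two are glued to each other and are handled by the alternative in
    [copy_link]. *)
Lemma star_label d e : e \in star d -> copy_label e = copy_label d ->
  e = d \/ e = copy_glue d.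
Proof.
have [link ends] := copy_link d.
have od := copy_label_other d; have ogd := copy_label_other (copy_glue d).
rewrite copy_label_glue in ogd.
have {}ends : copy_label (copy_other (copy_glue (copy_other d))) = copy_label d ->
    copy_other (copy_glue (copy_other d)) = copy_glue d.
  by case: ends => [/eqP|].
rewrite !inE; do 7?[case/orP=> [/eqP ->|]]; last move=> /eqP ->.
all: rewrite -?link ?copy_label_glue.
- by left.
- by right.
- by move/eqP; rewrite (negPf od).
- by move/eqP; rewrite (negPf ogd).
- by move/eqP; rewrite (negPf od).
- by move/eqP; rewrite (negPf ogd).
- by move/ends; right.
- by move/ends->; rewrite copy_glueK; left.
Qed.

(** Since [star d] is closed under both involutions, every polygon corner on a chain of
    identifications from [org d] is the origin of a dart of [star d]. *)
Lemma star_org d e : to_qvert copy_pairing (org d) = to_qvert copy_pairing (org e) ->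
  e \in star d.
Proof.
move/eqmodP => /connectP[t]; set r := (X in path X) => dt de.
have key f v : f \in star d -> org f = v -> forall t, path r v t ->
    exists2 f', f' \in star d & org f' = last v t.
  move=> + + t'; elim: t' f v => [|w t' IH] f v fd fv /=; first by exists f.
  case/andP=> vw /IH{}IH; suff [f' f'd f'w] : exists2 f', f' \in star d & org f' = w.
    exact: IH f'd f'w.
  case/orP: vw => /existsP[h /andP[/eqP hv /eqP hw]].
    exists (copy_glue h); last by rewrite hw.
    apply: star_glue; have [->|->] // := copy_eq_org (etrans fv hv).
    exact: star_other.
  have := copy_eq_org (etrans fv hw) => fh; exists h; last by rewrite hv.
  rewrite -[h]copy_glueK; apply: star_glue; case: fh => /= -> //.
  exact: star_other.
have [|f fd fe] := key d (org d) _ erefl t dt; first by rewrite !inE eqxx.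
by rewrite -de in fe; have [->|->] := copy_eq_org fe; rewrite // star_other.
Qed.

Notation skel := (skeleton double).

Definition skel_label (q : dart skel) : V2 :=
  copy_label (repr (q : finquot (glue_dart_rel copy_pairing))).

Lemma skel_labelE d : skel_label (to_qdart copy_pairing d) = copy_label d.
Proof.
rewrite /skel_label; case: (repr_to_qdart copy_pairing d) => -> //.
exact: copy_label_glue.
Qed.

Lemma qdartP (q : dart skel) : exists d, q = to_qdart copy_pairing d.
Proof.
exists (repr (q : finquot (glue_dart_rel copy_pairing))).
by rewrite /to_qdart reprK.
Qed.

Lemma skel_label_rev (q : dart skel) : skel_label (drev q) = vopp (skel_label q).
Proof.
have [d ->] := qdartP q; rewrite [drev _](esym (qrevE copy_pairing d)).
by rewrite !skel_labelE copy_label_rev.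
Qed.

Definition skel_map : gmap skel rose :=
  @GMap skel rose (fun=> tt) skel_label (fun=> erefl) skel_label_rev.

Lemma skel_map_immersion : immersion skel_map.
Proof.
move=> q q'; have [[d ->] [e ->]] := (qdartP q, qdartP q') => /=.
rewrite -!qorgE !skel_labelE => /star_org de ed.
by have [->|->] := star_label de (esym ed); rewrite ?(to_qdart_glue copy_pairing).
Qed.

Lemma skel_map_attach (i : 'I_2) (d : dart (circle n)) :
  gcomp skel_map (@attach double i) d = label c d.
Proof. exact: skel_labelE. Qed.

Lemma skel_attach_immersion (i : 'I_2) : immersion (gcomp skel_map (@attach double i)).
Proof.
move=> d e de; rewrite !skel_map_attach; case: (eq_org de) => -> // /eqP.
by rewrite eq_sym (negPf (label_other cN d)).
Qed.

Lemma skel_attach_reads (i : 'I_2) (w : F2) :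
  word w = [seq c j | j <- enum 'I_n] ->
  reads (gcomp skel_map (@attach double i)) w.
Proof.
move=> ww; exists (Ordinal n_gt0, false).
by rewrite ww -(labels_traject c n_gt0); apply: eq_map; apply: skel_map_attach.
Qed.

Lemma double_euler (d0 : dart (circle n)) :
  (label c (next_dart d0)).1 != (label c d0).1 ->
  (euler_char double < (ncells double)%:Z)%R.
Proof.
move=> turning; rewrite /euler_char.
suff : #|vert skel| < #|edge skel| by lia.
pose pi := to_qdart copy_pairing.
have uniq_pi s : uniq (map copy_label s) -> uniq (map pi s).
  move=> us; apply: (@map_uniq _ _ skel_label); rewrite -map_comp.
  by rewrite (eq_map (g := copy_label)) // => d; apply: skel_labelE.
have card_star (v : vert skel) s : uniq (map copy_label s) ->
    (forall d, d \in s -> to_qvert copy_pairing (org d) = v) ->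
    size s <= #|[pred q : dart skel | org q == v]|.
  move=> us sv; apply/card_geqP; exists (map pi s).
  rewrite uniq_pi // size_map; split=> // q /mapP[d ds ->].
  by rewrite inE /= -qorgE sv.
(* The copy is chosen so that [copy_glue] acts on [d1] by sigma. If the letter changes from x to y
   at the end of [d0], the origin of [d0] is inside a power, and the three darts listed below at
   [v1] have labels x, -x and -y. *)
pose d1 : D := on_copy (if (label c d0).2 then ord_max else ord0) d0.
pose v1 : vert skel := to_qvert copy_pairing (org d1).
apply: (@card_vert_lt_edge _ v1) => [v|].
  have [x ->] : exists x, v = to_qvert copy_pairing x.
    exists (repr (v : finquot (glue_vert_rel copy_pairing))).
    by rewrite /to_qvert reprK.
  case: x => i x; pose d := on_copy i (x, false).
  apply: (card_star _ [:: d; copy_other d]).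
    by rewrite /= inE eq_sym copy_label_other.
  by move=> e; rewrite !inE => /orP[]/eqP -> //; rewrite copy_org_other.
apply: (card_star _ [:: d1; copy_other d1; copy_other (copy_glue d1)]).
  have odd1 : odd (tag d1) == (label c d0).2 by rewrite /=; case: (_.2).
  have o1 : copy_label (copy_other d1) = vopp (label c d0).
    have -> : copy_label (copy_other d1) = label c (drev (prev_dart d0)).
      by rewrite /prev_dart drevK.
    rewrite label_rev (label_prev cI) //.
    by apply: contraNneq turning => ->.
  have o2 : copy_label (copy_other (copy_glue d1)) = vopp (label c (next_dart d0)).
    rewrite /copy_label /= (cross_pos odd1) other_next label_rev.
    by rewrite label_swap.
  have o2d := copy_label_other (copy_glue d1); rewrite copy_label_glue in o2d.
  rewrite /= !inE negb_or andbT (eq_sym (copy_label d1)) copy_label_other.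
  rewrite eq_sym o2d o1 o2 (inj_eq vopp_inj) /=.
  by apply: contraNneq turning => ->.
move=> e; rewrite !inE => /or3P[]/eqP -> //; rewrite ?copy_org_other //.
exact: (to_qvert_glue copy_pairing).
Qed.

End Surface.

(** * Cyclic words and products of powers *)

Lemma cycle_enumP (T : eqType) (e : rel T) n (c : 'I_n -> T) :
  reflect (forall i, e (c i) (c (ordS i))) (cycle e [seq c i | i <- enum 'I_n]).
Proof.
case: n c => [|n] c.
  by rewrite enum_ord0; apply: (iffP idP) => // _ [].
have nth_c j (jn : j < n.+1) : nth (c ord0) [seq c i | i <- enum 'I_n.+1] j = c (Ordinal jn).
  rewrite (nth_map ord0) ?size_enum_ord //; congr c.
  by apply: val_inj; rewrite /= nth_enum_ord.
have sz : size [seq c i | i <- enum 'I_n.+1] = n.+1 by rewrite size_map size_enum_ord.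
move: nth_c sz; case: [seq c i | i <- enum 'I_n.+1] => // x s nth_c [sz].
have nth_r j (jn : j < n.+1) : nth (c ord0) (rcons s x) j = c (ordS (Ordinal jn)).
  rewrite nth_rcons sz; case: (ltnP j n) => jn'.
    rewrite -[nth _ _ _]/(nth (c ord0) (x :: s) j.+1) nth_c //.
    by congr c; apply: val_inj; rewrite /= modn_small.
  (* At the last position [ordS] wraps around to 0, matching the head letter appended by [cycle]. *)
  have jE : j = n by apply/eqP; rewrite eqn_leq jn' -ltnS jn.
  rewrite {1}jE eqxx -[LHS]/(nth (c ord0) (x :: s) 0) nth_c; congr c.
  by apply: val_inj; rewrite /= jE modnn.
rewrite /cycle; apply: (iffP (pathP (c ord0))) => [es [i ilt]|ec j].
  have := es i; rewrite size_rcons sz nth_r -rcons_cons nth_rcons /= sz ilt nth_c.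
  by apply.
rewrite size_rcons sz => jn; rewrite nth_r -rcons_cons nth_rcons /= sz jn nth_c.
exact: ec.
Qed.

Section Powers.
Variable T : eqType.
Implicit Type s : seq (nat * T).

Definition power_word s : seq T := flatten [seq nseq q.1 q.2 | q <- s].

(** Steps inside a run hold by reflexivity, so only the passages between runs count. *)
Lemma path_power_word (e : rel T) s x : reflexive e -> all (fun q => 0 < q.1) s ->
  path e x (power_word s) = path e x (unzip2 s).
Proof.
move=> ee; elim: s x => //= -[[|m] y] s IH x //= sp.
rewrite -IH // /power_word /=; congr andb; elim: m => //= m ->.
by rewrite ee.
Qed.

Lemma last_power_word s x : all (fun q => 0 < q.1) s ->
  last x (power_word s) = last x (unzip2 s).
Proof.
elim: s x => //= -[[|m] y] s IH x //= sp.
rewrite -IH // /power_word /=; elim: m => //= m ->.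
Qed.

Lemma cycle_power_word (e : rel T) s : reflexive e -> all (fun q => 0 < q.1) s ->
  cycle e (power_word s) = cycle e (unzip2 s).
Proof.
case: s => // -[m x] s ee sp.
rewrite (cycle_path x) (cycle_path x) last_power_word //.
exact: path_power_word.
Qed.

Lemma power_word_noniso x0 s i : all (fun q => 1 < q.1) s ->
  i < size (power_word s) ->
  0 < i /\ nth x0 (power_word s) i = nth x0 (power_word s) i.-1 \/
  i.+1 < size (power_word s) /\
    nth x0 (power_word s) i = nth x0 (power_word s) i.+1.
Proof.
elim: s i => //= -[m y] s IH i /andP[/= m1 sp].
rewrite /power_word /= -/(power_word s) !size_cat size_nseq !nth_cat size_nseq.
case: (ltnP i m) => im ism.
  case: (ltnP i.+1 m) => im'; [right|left]; rewrite !nth_nseq.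
    by rewrite im im'; split=> //; lia.
  have -> : i.-1 < m by lia.
  by rewrite im; split=> //; lia.
have [|[i0 E]|[i0 E]] := IH (i - m) sp; first lia.
  left; have -> : i.-1 < m = false by lia.
  by rewrite E; split; [lia | congr nth; lia].
right; have -> : i.+1 < m = false by lia.
by rewrite E; split; [lia | congr nth; lia].
Qed.

End Powers.

Lemma word_prod (I : Type) (r : seq I) (F : I -> F2) :
  word (\prod_(i <- r) F i)%g =
  foldr push [::] (flatten [seq word (F i) | i <- r]).
Proof.
elim: r => [|i r IH]; first by rewrite big_nil.
by rewrite big_cons /= foldr_cat -IH.
Qed.

Lemma word_zpowg_gen (k : 'I_2) (p : int) : p != 0%R ->
  word (zpowg (gen k) p) = nseq `|p|%N (signed p k).
Proof.
have powE m : word (gen k ^+ m)%g = nseq m (k, false).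
  elim: m => // m IH; rewrite expgS /= IH.
  by case: m {IH} => //= m; rewrite /vopp xpair_eqE andbF.
case: p => [m|m] _; first exact: powE.
rewrite -[word _]/(rev (map vopp (word (gen k ^+ m.+1)%g))) powE map_nseq.
by rewrite rev_nseq.
Qed.

(** * The class of a word in the monoid and its decomposition into cycles *)

Section Rho.
Variables (n : nat) (c : 'I_n -> V2).
Hypothesis cN : cyc_noncancel c.
Local Open Scope ring_scope.

Lemma A2gen_bar (x y : V2) : A2gen (vopp y) (vopp x) = A2gen x y.
Proof.
rewrite /A2gen; case: insubP => [e _ eE|]; case: insubP => [e' _ eE'|] //.
- apply/eqmodP/asboolP/cong_sym/cong_base; exists e'; split=> //.
  congr basis; apply: val_inj; rewrite eE /= eE' //.
- by have := valP e; rewrite eE /inE2 /= /vabs /= eq_sym => ->.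
- by have := valP e'; rewrite eE' /inE2 /= /vabs /= eq_sym => ->.
Qed.

(** Each corner has two readings with the same value of f. As generators alternate, exactly one of
    them enters along the first generator. *)
Lemma rho_corners (f : V2 -> V2 -> A2) :
  (forall i, (c i).1 != (c (ordS i)).1) ->
  (forall x y, f (vopp y) (vopp x) = f x y) ->
  \sum_i f (c i) (c (ordS i)) =
  \sum_(d : dart (circle n) | (label c d).1 == ord0) f (label c d) (label c (next_dart d)).
Proof.
move=> alt fsym.
transitivity (\sum_i \sum_b if (label c (i, b)).1 == ord0 then
    f (label c (i, b)) (label c (next_dart (i, b))) else 0); last first.
  by rewrite pair_bigA [RHS]big_mkcond; apply: eq_bigr => -[].
under [RHS]eq_bigr do rewrite big_bool.
(* The corner between i and i + 1 is read backwards from the dart [(ordS i, true)], hence the shift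
   of index. *)
rewrite big_split /= [X in _ = X + _](reindex_inj (can_inj (@ordSK n))) -big_split /=.
apply: eq_bigr => i _; rewrite /label /next_dart /= ordSK fsym.
rewrite (ord2_neq (alt i)); case: eqP => _ /=.
  by rewrite GRing.add0r.
by rewrite GRing.addr0.
Qed.

Lemma T2_mulrn (x : A2) m : T2 x -> T2 (x *+ m).
Proof.
move=> Tx; elim: m => [|m IH]; first exact: submonoid_gen_0.
by rewrite GRing.mulrS; apply: submonoid_gen_add.
Qed.

Lemma T2_pair (x y : V2) : x.1 != y.1 -> T2 (A2gen x y + A2gen y x).
Proof.
move=> xy; apply: submonoid_gen_base.
exists 2, (fun i : 'I_2 => if i == ord0 then x else y); split=> //.
- move=> [[|[|//]] ?] [[|[|//]] ?] /= E; apply: val_inj => //=;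
  by move: xy; rewrite E eqxx.
- by move=> [[|[|//]] ?]; rewrite /inE2 //= eq_sym.
- by rewrite !big_ord_recl big_ord0 GRing.addr0.
Qed.

Lemma T2_alternating : (forall i, (c i).1 != (c (ordS i)).1) ->
  T2 (\sum_i A2gen (c i) (c (ordS i))).
Proof.
move=> alt; rewrite (rho_corners alt A2gen_bar).
have alt_d (d : dart (circle n)) : (label c d).1 != (label c (next_dart d)).1.
  case: d => i []; rewrite /label //=.
  by rewrite -{1}[i]ord_predK eq_sym alt.
pose x b : V2 := (ord0, b); pose y b : V2 := (ord_max, b).
have -> : \sum_(d : dart (circle n) | (label c d).1 == ord0)
    A2gen (label c d) (label c (next_dart d)) =
  \sum_b \sum_b' A2gen (x b) (y b') *+ corners c (x b) (y b').
  under [RHS]eq_bigr do under eq_bigr do rewrite /corners -GRing.sumrMnr.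
  rewrite big_mkcond; under [RHS]eq_bigr do rewrite exchange_big.
  rewrite exchange_big; apply: eq_bigr => d _; rewrite !big_bool.
  move: (label c d) (label c (next_dart d)) (alt_d d) => [k b] [k' b'] /= kk'.
  have [k0 | kN] := eqVneq k ord0; last first.
    by rewrite !xpair_eqE (negPf kN) /= !GRing.addr0.
  have := ord2_neq kk'; rewrite {}k0 eqxx => /negbT k'0.
  have -> : k' = ord_max by move: k'0; case: (k') => [[|[|//]] ?] //= _; apply: val_inj.
  rewrite !xpair_eqE !eqxx /=; case: b b' => -[] /=;
    by rewrite ?GRing.add0r ?GRing.addr0.
rewrite !big_bool /=.
(* The relation of the monoid turns (-1, -y) into (y, 1), and [cornersC] gives it the multiplicity
   of (1, y). The four terms thus pair into multiples of two 2-cycles. *)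
have flip b : A2gen (x true) (y (~~ b)) *+ corners c (x true) (y (~~ b)) =
    A2gen (y b) (x false) *+ corners c (x false) (y b).
  rewrite -A2gen_bar -corners_turn (cornersC cN) //.
  by rewrite /vopp /= negbK.
rewrite (flip false) (flip true) [X in _ + X]GRing.addrC GRing.addrACA.
rewrite -!GRing.mulrnDl.
by apply: submonoid_gen_add; apply: T2_mulrn; rewrite GRing.addrC; apply: T2_pair.
Qed.

End Rho.

(** * Polygonality of words without isolated generators *)

Lemma polygonal_word n (c : 'I_n -> V2) (w : F2) :
  word w = [seq c i | i <- enum 'I_n] -> cyc_noncancel c -> no_isolated c ->
  (exists i, (c i).1 != (c (ordS i)).1) -> polygonal w.
Proof.
move=> ww cN cI [i turning]; split.
  by rewrite /cyclically_reduced ww; apply/cycle_enumP.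
have n_gt0 : 0 < n := leq_ltn_trans (leq0n i) (ltn_ord i).
exists (double n_gt0 cN); split; last first.
  by apply: (@double_euler _ _ n_gt0 cN cI (i, false)); rewrite eq_sym.
exists (skel_map n_gt0 cN); split; first exact: skel_map_immersion.
move=> j; split; first exact: skel_attach_immersion.
exists 1%R; split=> //; apply: skel_attach_reads.
by rewrite [zpowg _ _]expg1.
Qed.

Theorem theorem4p6 (l : nat) (k : 'I_l -> 'I_2) (p : 'I_l -> int)
    (l_gt0 : 0 < l)
    (k_alt : forall i : 'I_l, k i <> k (ordS i))
    (p_gt1 : forall i : 'I_l, (1 < `|p i|)%R) :
  T2 (rho k p) /\ polygonal (\prod_(i < l) zpowg (gen (k i)) (p i))%g.
Proof.
(* Only the signs of the exponents enter [rho], so membership in [T2] is proved on the word with one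
   letter per power. *)
pose x i := signed (p i) (k i).
have alt i : (x i).1 != (x (ordS i)).1 by apply/eqP/k_alt.
have xN : cyc_noncancel x.
  by move=> i; rewrite /noncancel /= xpair_eqE eq_sym (negPf (alt i)).
split; first exact: T2_alternating.
pose s := [seq (`|p i|%N, x i) | i <- enum 'I_l]; pose W := power_word s.
have sx : unzip2 s = [seq x i | i <- enum 'I_l] by rewrite /unzip2 -map_comp.
have s_gt1 : all (fun q => 1 < q.1) s.
  by apply/allP => _ /mapP[i _ ->] /=; have := p_gt1 i; lia.
have s_gt0 : all (fun q => 0 < q.1) s by apply: sub_all s_gt1 => q /ltnW.
have WN : cycle noncancel W.
  rewrite cycle_power_word //; last exact: noncancel_refl.
  by rewrite sx; apply/cycle_enumP.
(* This provides the change of generator from which a vertex of degree above 2 arises. *)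
have W_alt : ~~ cycle (fun a b : V2 => a.1 == b.1) W.
  rewrite cycle_power_word // sx; apply/negP => /cycle_enumP E.
  by have /negP := alt (Ordinal l_gt0); apply; apply: E.
have wW : word (\prod_(i < l) zpowg (gen (k i)) (p i))%g = W.
  (* [W] is already reduced, so free reduction of the concatenated powers leaves it unchanged. *)
  rewrite word_prod -[RHS]push_reduced; last first.
    by case: (W) WN => //= a W'; rewrite rcons_path => /andP[].
  congr (foldr push [::] (flatten _)); rewrite /s -map_comp enumT [index_enum _]unlock.
  apply: eq_map => i /=; apply: word_zpowg_gen.
  by apply: contraTneq (p_gt1 i) => ->.
case W0 : W => [|a W']; first by rewrite W0 in W_alt.
pose c (i : 'I_(size W)) := nth a W i.
have Wc : W = [seq c i | i <- enum 'I_(size W)].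
  apply: (@eq_from_nth _ a) => [|i iW]; first by rewrite size_map size_enum_ord.
  rewrite (nth_map (Ordinal iW)) ?size_enum_ord // /c.
  by rewrite nth_enum_ord.
apply: (@polygonal_word _ c); first by rewrite -Wc.
- by apply/cycle_enumP; rewrite -Wc.
- move=> i; have [[i0 E]|[iW E]] := power_word_noniso a s_gt1 (ltn_ord i).
    left; rewrite /c [LHS]E /=; congr nth.
    (* [ord_pred] is computed modulo [size W] after adding [size W]; as i > 0 it is the plain
       predecessor. *)
    have -> : (i + size W).-1 = i.-1 + size W by move: i0; case: (nat_of_ord i).
    by rewrite modnDr modn_small // (leq_ltn_trans (leq_pred i)).
  by right; rewrite /c [LHS]E /= modn_small.
- apply/existsP; rewrite -negb_forall; apply: contra W_alt => /forallP Wa.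
  by rewrite Wc; apply/cycle_enumP.
Qed.
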